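(* Let $\mathcal{A}$ be a $\sigma$-structure, $\{I_\alpha\}_{\alpha\in\mathbf{On}}$ a family of index sets and $\{\mathcal{U}_\alpha\}_{\alpha\in\mathbf{On}}$ ultrafilters with $\mathcal{U}_\alpha$ over $I_\alpha$. Let the cumulative power hierarchy and the ultrapower hierarchy of $\mathcal{A}$ both be generated by $\{I_\alpha\}$ (the latter with the ultrafilters $\{\mathcal{U}_\alpha\}$). For every ordinal $\gamma$: if for all $\beta<\gamma$ the relation $\sim_{\beta+1}$ is defined using $\mathcal{U}_\beta$, then $\mathbb{F}_\gamma(\mathcal{A})\cong\Upsilon_\gamma(\mathcal{A})$.
   Context: Index sets have cardinality greater than $1$. Cumulative power hierarchy: $\mathcal{F}_0(A)=A$, $\mathcal{F}_{\beta+1}(A)=\mathcal{F}_\beta(A)^{I_\beta}\cup\mathcal{F}_\beta(A)$ ($X^I$ = functions $I\to X$), $\mathcal{F}_\lambda(A)=\bigcup_{\alpha<\lambda}\mathcal{F}_\alpha(A)$ for limit $\lambda$; $\rho(a)$ is the least $\beta$ with $a\in\mathcal{F}_\beta(A)$; $\vartheta^\alpha_j(a)=a(j)$ if $\rho(a)\ge\alpha$ and $j\in\mathrm{dom}(a)$, else $a$. For each $n$-ary function symbol $F$ and relation symbol $R$, with $\delta=\max_i\rho(a_i)$: if $\delta=0$, $F_\beta,R_\beta$ agree with $\mathcal{A}$; if $\delta>0$, $F_\beta(a_1,\dots,a_n)$ is the unique $b$ with $\rho(b)=\delta$ and $b(j)=F_{\delta-1}(\vartheta^\delta_j(a_1),\dots,\vartheta^\delta_j(a_n))$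 for all $j\in I_{\delta-1}$, and $R_\beta(a_1,\dots,a_n)$ iff $R_{\delta-1}(\vartheta^\delta_j(a_1),\dots,\vartheta^\delta_j(a_n))$ for all $j\in I_{\delta-1}$. Relations $\sim_\beta$: $a\sim_0b$ iff $a=b$; with $\delta=\max(\rho(a),\rho(b))$, $a\sim_{\beta+1}b$ iff $\{j\in I_\beta\mid\vartheta^\delta_j(a)\sim_\beta\vartheta^\delta_j(b)\}\in\mathcal{U}_\beta$ (this is what ''$\sim_{\beta+1}$ defined using $\mathcal{U}_\beta$'' means); $\sim_\lambda=\bigcup_{\alpha<\lambda}\sim_\alpha$ at limits. $\mathbb{F}_\beta(\mathcal{A})$ is the $\sigma$-structure on $\mathcal{F}_\beta(A)/\!\sim_\beta$ with $F([x_1],\dots,[x_n])=[F_\beta(x_1,\dots,x_n)]$, constants $c$ as $[c^{\mathcal{A}}]$, and $R([a_1],\dots,[a_n])$ iff there are $b_i\in\mathcal{F}_\beta(A)$ with $a_i\sim_\beta b_i$ and $R_\beta(b_1,\dots,b_n)$. Ultrapower hierarchy: $\Upsilon_0(\mathcal{A})=\mathcal{A}$; $\Upsilon_{\alpha+1}(\mathcal{A})=\Upsilon_\alpha(\mathcal{A})^{I_\alpha}/\mathcal{U}_\alpha$; for limit $\lambda$, $\Upsilon_\lambda(\mathcal{A})$ is the direct limit of $\Upsilon_\alpha(\mathcal{A})$, $\alpha<\lambda$, along the maps $e^\alpha_\alpha=\mathrm{id}$, $e^\alpha_{\beta+1}(x)=[\text{constant function with value }e^\alpha_\beta(x)]_{\mathcal{U}_\beta}$,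 and canonical maps into direct limits at limit stages.
   Formalization: Functions on I_α and I_β with α≠β count as distinct (index sets treated as pairwise disjoint) and elements of A are not functions; with overlapping index sets, e.g. I_0=I_1 and U_0≠U_1, the relation ~_2 need not be transitive and the quotient is undefined. *)

(* Defs.v *)
From mathcomp Require Import all_boot all_order.
From mathcomp Require Import boolp classical_sets filter.

Set Implicit Arguments.
Unset Strict Implicit.
Unset Printing Implicit Defensive.

Import Order.TTheory.
Local Open Scope classical_set_scope.
Local Open Scope order_scope.

(** * First-order structures *)

Record signature := Signature {
  csym : Type;
  fsym : Type;
  far : fsym -> nat;
  far_gt0 : forall f, (0 < far f)%N;
  rsym : Type;
  rar : rsym -> nat;
  rar_gt0 : forall r, (0 < rar r)%N
}.

Record structure (s : signature) := Structure {
  carrier :> Type;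
  cstI : csym s -> carrier;
  fctI : forall f : fsym s, ('I_(far f) -> carrier) -> carrier;
  relI : forall r : rsym s, ('I_(rar r) -> carrier) -> Prop
}.
Arguments Structure {s carrier} cstI fctI relI.
Arguments cstI {s} M c : rename.
Arguments fctI {s} M f x : rename.
Arguments relI {s} M r x : rename.

Definition arg0 (s : signature) (f : fsym s) : 'I_(far f) :=
  Ordinal (far_gt0 f).

Definition isomorphic (s : signature) (M N : structure s) : Prop :=
  exists h : M -> N,
    [/\ bijective h,
        forall c, h (cstI M c) = cstI N c,
        forall f x, h (fctI M f x) = fctI N f (fun i => h (x i)) &
        forall r x, relI M r x <-> relI N r (fun i => h (x i))].

(** * Quotients *)

(* The set of all [{y | R x y}]; this is the quotient by [R] as soon as [R] is
   an equivalence relation, which the definition does not require. *)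
Definition quot (T : Type) (R : T -> T -> Prop) : Type :=
  {C : set T | exists x, C = [set y | R x y]}.

Definition cls (T : Type) (R : T -> T -> Prop) (x : T) : quot R :=
  exist _ [set y | R x y] (ex_intro _ x erefl).

Definition repr (T : Type) (R : T -> T -> Prop) (C : quot R) : T :=
  projT1 (cid (proj2_sig C)).

Lemma reprK (T : Type) (R : T -> T -> Prop) (C : quot R) : cls R (repr C) = C.
Proof.
rewrite /repr; case: cid => x; case: C => C hC /= E; exact/eq_exist/esym.
Qed.

(** * Ultrapowers *)

Section Ultrapower.
Variables (s : signature) (J : Type) (D : set_system J) (M : structure s).

Definition ae_eq (x y : J -> M) : Prop := D [set j | x j = y j].

Definition ultrapower : structure s :=
  @Structure s (quot ae_eq)
    (fun c => cls ae_eq (fun _ => cstI M c))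
    (fun f x => cls ae_eq (fun j => fctI M f (fun i => repr (x i) j)))
    (fun r x => D [set j | relI M r (fun i => repr (x i) j)]).

Definition diag (x : M) : ultrapower := cls ae_eq (fun _ => x).

End Ultrapower.

(** * Direct limits *)

Section DirectLimit.
Variables (s : signature) (K : Type) (k0 : K) (M : K -> structure s).
(* [E i j f] means that there is an arrow from [i] to [j] and that [f] is the
   transition map along it. *)
Variable E : forall i j, (M i -> M j) -> Prop.

Definition dl_eq (p q : {k : K & M k}) : Prop :=
  exists k (f : M (projT1 p) -> M k) (g : M (projT1 q) -> M k),
    [/\ E f, E g & f (projT2 p) = g (projT2 q)].

Definition dl_in (k : K) (x : M k) : quot dl_eq := cls dl_eq (existT _ k x).

(* Finitely many elements of a direct limit always come from a single [M k];
   the default value of [xget] is thus irrelevant, as are the choices of [k] and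
   [x]. *)
Definition dirlim : structure s :=
  @Structure s (quot dl_eq)
    (fun c => dl_in (cstI (M k0) c))
    (fun f y => @xget {classic quot dl_eq} (y (arg0 f))
       [set z | exists k (x : 'I_(far f) -> M k),
          (forall i, y i = dl_in (x i)) /\ z = dl_in (fctI (M k) f x)])
    (fun r y => exists k (x : 'I_(rar r) -> M k),
          (forall i, y i = dl_in (x i)) /\ relI (M k) r x).

Definition dl_map (k : K) (x : M k) : dirlim := dl_in x.

End DirectLimit.

(** * Transfinite recursion over a well-ordered type with least element [\bot] *)

Section Recursion.
Context {d : Order.disp_t} {O : bOrderType d}.
Hypothesis wfO : well_founded (fun x y : O => x < y).

Definition is_succ (b g : O) : Prop := b < g /\ forall a, a < g -> a <= b.

Definition is_limit (g : O) : Prop :=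
  g != \bot /\ forall b, ~ is_succ b g.

Variant ord_case (g : O) : Type :=
| OZero of g = \bot
| OSucc b of is_succ b g
| OLim of is_limit g.

Definition ord_caseP (g : O) : ord_case g.
Proof.
case: (eqVneq g \bot) => [g0|gN0]; first exact: OZero.
case: (pselect (exists b, is_succ b g)) => [/cid[b bg]|nsucc].
  exact: (OSucc bg).
by apply: OLim; split=> // b bg; apply: nsucc; exists b.
Qed.

Lemma succ_inj b b' g : is_succ b g -> is_succ b' g -> b = b'.
Proof.
by move=> [bg H] [b'g H']; apply/eqP; rewrite eq_le H' // H.
Qed.

Lemma ltSE b g a : is_succ b g -> (a < g) = (a <= b).
Proof.
move=> [bg H]; apply/idP/idP => [/H//|ab]; exact: le_lt_trans bg.
Qed.

Lemma succ_neq0 b g : is_succ b g -> g <> \bot.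
Proof. by move=> [+ _] g0; rewrite g0 ltx0. Qed.

(* [body g prev] is the value at [g]; [prev] gives the values below [g] and is
   the junk value [t0] elsewhere. *)
Definition wfrec (T : Type) (t0 : T) (body : O -> (O -> T) -> T) : O -> T :=
  Fix wfO (fun _ => T)
    (fun g prev => body g (fun a =>
       if pselect (a < g) is left h then prev a h else t0)).

Lemma wfrecE (T : Type) (t0 : T) body g :
  wfrec t0 body g = body g (fun a => if a < g then wfrec t0 body a else t0).
Proof.
rewrite /wfrec Fix_eq; last first.
  move=> x f f' ff'; congr (body x _); apply/funext => a.
  by case: pselect.
congr (body g _); apply/funext => a.
by case: pselect => [->//|/negP/negbTE->].
Qed.

Definition ordrec (T : Type) (H0 : T) (HS : O -> O -> T -> T)
    (HL : forall l, is_limit l -> (O -> T) -> T) : O -> T :=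
  wfrec H0 (fun g prev =>
    match ord_caseP g with
    | OZero _ => H0
    | OSucc b _ => HS b g (prev b)
    | OLim lim => HL g lim prev
    end).

Lemma ordrec0 T H0 HS HL : @ordrec T H0 HS HL \bot = H0.
Proof.
rewrite /ordrec wfrecE; case: ord_caseP => // [b /succ_neq0//|lim].
by have [] := lim; rewrite eqxx.
Qed.

Lemma ordrecS T H0 HS HL b g : is_succ b g ->
  @ordrec T H0 HS HL g = HS b g (ordrec H0 HS HL b).
Proof.
move=> bg; rewrite /ordrec wfrecE; case: ord_caseP => [g0|b' b'g|lim].
- by case: (succ_neq0 bg).
- by rewrite (succ_inj b'g bg) bg.1.
- by case: (lim.2 b).
Qed.

Lemma ordrecL T H0 HS HL g (lim : is_limit g) :
  @ordrec T H0 HS HL g =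
  HL g lim (fun a => if a < g then ordrec H0 HS HL a else H0).
Proof.
rewrite {1}/ordrec wfrecE; case: ord_caseP => [g0|b bg|lim'].
- by case/eqP: lim.1.
- by case: (lim.2 b).
- by congr (HL g _ _); exact: Prop_irrelevance.
Qed.

End Recursion.

(** * The cumulative power hierarchy *)

Section CumulativePower.
Context {d : Order.disp_t} {O : bOrderType d}.
Hypothesis wfO : well_founded (fun x y : O => x < y).
Variables (I : O -> Type) (s : signature) (A : structure s).

(* The hereditary functions over [A]: [atom a] is [a] itself and [Fun b h] is
   the function [h] with domain [I b]. Elements of [A] are not functions, and
   functions with domains [I b] and [I b'] differ when [b <> b'], i.e. the index
   sets are taken pairwise disjoint: if they were allowed to overlap, [sim]
   below would not be transitive in general. *)
Inductive elt : Type :=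
| atom of A
| Fun b of (I b -> elt).

Definition cph : O -> set elt :=
  ordrec wfO (range atom)
    (fun b _ X => [set a | exists2 h : I b -> elt, forall j, X (h j) & a = Fun h]
                  `|` X)
    (fun l _ X => [set a | exists2 b, b < l & X b a]).

Definition rho (a : elt) : O :=
  xget \bot [set b | cph b a /\ forall c, cph c a -> b <= c].

Definition theta (al : O) (b : O) (j : I b) (a : elt) : elt :=
  if al <= rho a then
    match a with
    | atom _ => a
    | Fun c h =>
      match b =P c with
      | ReflectT e => h (eq_rect b I j c e)
      | ReflectF _ => a
      end
    end
  else a.

Definition maxrho (n : nat) (a : 'I_n -> elt) : O :=
  \big[Order.max / \bot]_(i < n) rho (a i).

(* On elements of the hierarchy, [maxrho a] is never a limit. For [maxrho a] the
   successor of [e], the elements of that rank are the functions on [I e] with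
   values in [cph e], so that the value below is the only one with the prescribed
   components. *)
Definition cph_fct (f : fsym s) : O -> ('I_(far f) -> elt) -> elt :=
  wfrec wfO (fun a => a (arg0 f))
    (fun _ prev a =>
       match ord_caseP (maxrho a) with
       | OZero _ => @xget {classic elt} (a (arg0 f))
           [set b | exists x, (forall i, a i = atom (x i)) /\
                              b = atom (fctI A f x)]
       | OSucc e _ => Fun (fun j : I e =>
           prev e (fun i => theta (maxrho a) j (a i)))
       | OLim _ => a (arg0 f)
       end).

Definition cph_rel (r : rsym s) : O -> ('I_(rar r) -> elt) -> Prop :=
  wfrec wfO (fun _ => False)
    (fun _ prev a =>
       match ord_caseP (maxrho a) with
       | OZero _ => exists x, (forall i, a i = atom (x i)) /\ relI A r x
       | OSucc e _ => forall j : I e,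
           prev e (fun i => theta (maxrho a) j (a i))
       | OLim _ => False
       end).

(* [V b] is the set system with which the relation at stage [b + 1] is
   defined. *)
Definition sim (V : forall b, set_system (I b)) : O -> elt -> elt -> Prop :=
  ordrec wfO (fun a b => cph \bot a /\ a = b)
    (fun be g S a b =>
       [/\ cph g a, cph g b &
           V be [set j | S (theta (Order.max (rho a) (rho b)) j a)
                           (theta (Order.max (rho a) (rho b)) j b)]])
    (fun l _ S a b => exists2 al, al < l & S al a b).

Lemma cph0 : cph \bot = range atom.
Proof. exact: ordrec0. Qed.

Lemma cphS b g : is_succ b g ->
  cph g = [set a | exists2 h : I b -> elt, forall j, cph b (h j) & a = Fun h]
          `|` cph b.
Proof. by move=> bg; rewrite /cph (ordrecS _ _ _ _ bg). Qed.

Lemma cphL l : is_limit l -> cph l = [set a | exists2 b, b < l & cph b a].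
Proof.
move=> lim; rewrite /cph (ordrecL _ _ _ _ lim).
by apply/seteqP; split=> a [b bl] H; exists b => //; rewrite bl in H *.
Qed.

Lemma cph_mono b g : b <= g -> cph b `<=` cph g.
Proof.
elim/(well_founded_induction wfO): g b => g IH b bg a Hb.
have [<-//|bNg] := eqVneq b g.
have {bNg}bg : b < g by rewrite lt_neqAle bNg.
case: (ord_caseP g) => [g0|e eg|lim].
- by rewrite g0 ltx0 in bg.
- rewrite (cphS eg); right; apply: (IH e eg.1 b) => //.
  by rewrite -(ltSE _ eg).
- by rewrite (cphL lim); exists b.
Qed.

Lemma atom_cph (x : A) g : cph g (atom x).
Proof. by apply: (cph_mono (le0x g)); rewrite cph0; exists x. Qed.

Lemma rhoP g a : cph g a ->
  [/\ cph (rho a) a, forall c, cph c a -> rho a <= c & rho a <= g].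
Proof.
move=> ga; have : exists b, cph b a /\ forall c, cph c a -> b <= c.
  elim/(well_founded_induction wfO): g ga => g IH ga.
  have [[c [cg ca]]|H] := pselect (exists c, c < g /\ cph c a).
    exact: (IH c).
  exists g; split=> // c ca; rewrite leNgt; apply/negP => cg.
  by apply: H; exists c.
by move=> /(xgetPex \bot)[H1 H2]; split=> //; exact: H2.
Qed.

Lemma rho_Nlimit g a : cph g a -> ~ is_limit (rho a).
Proof.
move=> /rhoP[ra min _] lim; move: ra; rewrite (cphL lim) => -[b br /min].
by rewrite leNgt br.
Qed.

Lemma rho0 g a : cph g a -> rho a = \bot -> exists x, a = atom x.
Proof. by move=> /rhoP[+ _ _] r0; rewrite r0 cph0 => -[x _ <-]; exists x. Qed.

Lemma rhoS g a e : cph g a -> is_succ e (rho a) ->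
  exists2 h : I e -> elt, forall j, cph e (h j) & a = Fun h.
Proof.
move=> /rhoP[+ min _] er; rewrite (cphS er) => -[//|/min].
by rewrite leNgt er.1.
Qed.

Lemma theta_cph e de a (j : I e) :
  is_succ e de -> cph de a -> cph e (theta de j a).
Proof.
move=> ed da; have [ra min rd] := rhoP da; rewrite /theta.
case: ifPn => [dr|].
  have rE : rho a = de by apply/eqP; rewrite eq_le rd.
  rewrite -rE in ed; have [h hh ->] := rhoS da ed.
  case: eqP => // ee; rewrite (Prop_irrelevance ee erefl); exact: hh.
rewrite -ltNge (ltSE _ ed) => re; exact: cph_mono re _ ra.
Qed.

Lemma rho_le_max n (a : 'I_n -> elt) i : rho (a i) <= maxrho a.
Proof. exact: (le_bigmax _ (fun i => rho (a i)) i). Qed.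

Lemma maxrho_ex n (a : 'I_n -> elt) : (0 < n)%N ->
  exists i, maxrho a = rho (a i).
Proof.
move=> n0; rewrite /maxrho.
have [//|i _|i _ ->] := eq_bigmax (x := \bot) (Ordinal n0) predT (rho \o a).
  exact: le0x.
by exists i.
Qed.

Lemma cph_fct_closed (f : fsym s) g (a : 'I_(far f) -> elt) :
  (forall i, cph g (a i)) -> cph g (cph_fct g a).
Proof.
elim/(well_founded_induction wfO): g a => g IH a ga.
rewrite /cph_fct wfrecE.
have [i0 mE] := maxrho_ex a (far_gt0 f).
have mg : maxrho a <= g by rewrite mE; case: (rhoP (ga i0)).
case: ord_caseP => [m0|e em|lim]; last exact: ga.
- case: xgetP => [b _ [x [_ ->]]|_]; [exact: atom_cph | exact: ga].
- have eg : e < g by exact: lt_le_trans em.1 mg.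
  apply: (cph_mono mg); rewrite (cphS em); left; eexists; last by [].
  move=> j /=; rewrite eg; apply: IH => // i; apply: theta_cph => //.
  have [ra _ _] := rhoP (ga i); exact: cph_mono (rho_le_max a i) _ ra.
Qed.

Section CumulativeStructure.
Variables (V : forall b, set_system (I b)) (g : O).

Definition csim (a b : {a : elt | cph g a}) : Prop :=
  sim V g (sval a) (sval b).

Definition cumpower : structure s :=
  @Structure s (quot csim)
    (fun c => cls csim (exist _ (atom (cstI A c)) (atom_cph (cstI A c) g)))
    (fun f x => cls csim
       (exist _ (cph_fct g (fun i => sval (repr (x i))))
                (cph_fct_closed (fun i => svalP (repr (x i))))))
    (fun r x => exists b : 'I_(rar r) -> {a : elt | cph g a},
       (forall i, csim (repr (x i)) (b i)) /\
       cph_rel g (fun i => sval (b i))).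

End CumulativeStructure.

End CumulativePower.

(** * The ultrapower hierarchy *)

(* [f] and [h] are the same map, with the same source. *)
Variant same_map (s : signature) (M N : structure s) (h : M -> N) :
    forall T : structure s, (T -> N) -> Prop :=
  SameMap : same_map h h.

Section UltrapowerHierarchy.
Context {d : Order.disp_t} {O : bOrderType d}.
Hypothesis wfO : well_founded (fun x y : O => x < y).
Variables (I : O -> Type) (U : forall b, set_system (I b)).
Variables (s : signature) (A : structure s).

(* Structures and maps are built together: at stage [g], [trans a f] means that
   the source of [f] is the structure of stage [a <= g] and that [f] is the
   canonical map from it to the structure of stage [g]. *)
Record stage := Stage {
  str : structure s;
  trans : O -> forall T : structure s, (T -> str) -> Prop
}.

Definition with_id (g : O) (M : structure s)
    (E : O -> forall T : structure s, (T -> M) -> Prop) : stage :=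
  @Stage M (fun a T f => (a = g /\ same_map (@id M) f) \/ E a T f).

Definition stage0 : stage := @with_id \bot A (fun _ _ _ => False).

Definition stageS (b g : O) (X : stage) : stage :=
  @with_id g (ultrapower (@U b) (str X)) (fun a T f =>
    exists2 h : T -> str X, @trans X a T h & f = fun x => diag (@U b) (h x)).

Definition below (l : O) : Type := {a : O | a < l}.

Lemma limit_gt0 (l : O) : is_limit l -> \bot < l.
Proof. by case=> l0 _; rewrite lt0x. Qed.

Definition stageL (l : O) (lim : is_limit l) (X : below l -> stage) : stage :=
  let E (i j : below l) (f : str (X i) -> str (X j)) :=
    trans (sval i) f in
  let k0 : below l := exist _ \bot (limit_gt0 lim) in
  @with_id l (dirlim k0 E) (fun a T f =>
    exists al : a < l, same_map (dl_map k0 E (k := exist _ a al)) f).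

Definition ultra_stage : O -> stage :=
  ordrec wfO stage0 stageS
    (fun l lim X => stageL lim (fun k => X (sval k))).

Definition ultrahier (g : O) : structure s := str (ultra_stage g).

Definition is_ultra_map (a g : O) (f : ultrahier a -> ultrahier g) : Prop :=
  trans a f.

Lemma ultra_stage0 : ultra_stage \bot = stage0.
Proof. exact: ordrec0. Qed.

Lemma ultra_stageS b g : is_succ b g ->
  ultra_stage g = stageS b g (ultra_stage b).
Proof. exact: ordrecS. Qed.

Lemma ultra_stageL l (lim : is_limit l) :
  ultra_stage l = stageL lim (fun k => ultra_stage (sval k)).
Proof.
rewrite {1}/ultra_stage (ordrecL _ _ _ _ lim); congr (stageL lim _).
by apply/funext => -[a al] /=; rewrite al.
Qed.

Lemma ultrahier0 : ultrahier \bot = A.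
Proof. by rewrite /ultrahier ultra_stage0. Qed.

Lemma ultrahierS b g : is_succ b g ->
  ultrahier g = ultrapower (@U b) (ultrahier b).
Proof. by move=> bg; rewrite /ultrahier (ultra_stageS bg). Qed.

Lemma ultrahierL l (lim : is_limit l) :
  ultrahier l =
  dirlim (exist _ \bot (limit_gt0 lim) : below l)
    (fun i j => @is_ultra_map (sval i) (sval j)).
Proof. by rewrite /ultrahier (ultra_stageL lim). Qed.

Lemma same_map_eq (M N : structure s) (h f : M -> N) : same_map h f -> f = h.
Proof.
have gen (T : structure s) (k : T -> N) : same_map h k ->
    exists e : M = T, k = eq_rect M (fun T : structure s => T -> N) h T e.
  by case; exists erefl.
by move=> /gen[e ->]; rewrite (Prop_irrelevance e erefl).
Qed.

Lemma ultra_trans_le g a (T : structure s) (f : T -> str (ultra_stage g)) :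
  trans a f -> a <= g.
Proof.
elim/(well_founded_induction wfO): g a T f => g IH a T f.
case: (ord_caseP g) => [g0|b bg|lim].
- by subst g; move: f; rewrite ultra_stage0 => f -[[-> _]|].
- move: f; rewrite (ultra_stageS bg) => f -[[-> _]//|[h hT _]].
  exact: le_trans (IH b bg.1 _ _ _ hT) (ltW bg.1).
- move: f; rewrite (ultra_stageL lim) => f -[[-> _]//|[al _]]; exact: ltW.
Qed.

Lemma ultra_map_unique a g : a <= g -> exists! f, @is_ultra_map a g f.
Proof.
rewrite /is_ultra_map /ultrahier.
have idP' h : @trans (ultra_stage h) h (str (ultra_stage h)) id.
  case: (ord_caseP h) => [->|b bh|lim].
  - by rewrite ultra_stage0; left.
  - by rewrite (ultra_stageS bh); left.
  - by rewrite (ultra_stageL lim); left.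
elim/(well_founded_induction wfO): g a => g IH a.
rewrite le_eqVlt => /predU1P[->|ag].
  exists id; split; first exact: idP'.
  case: (ord_caseP g) => [->|b bg|lim].
  - by rewrite ultra_stage0 => f -[[_ /same_map_eq]|].
  - rewrite (ultra_stageS bg) => f -[[_ /same_map_eq]//|[h /ultra_trans_le gb]].
    by have := bg.1; rewrite ltNge gb.
  - rewrite (ultra_stageL lim) => f -[[_ /same_map_eq]//|[gg]].
    by have := gg; rewrite ltxx.
case: (ord_caseP g) => [g0|b bg|lim].
- by rewrite g0 ltx0 in ag.
- have ab : a <= b by rewrite -(ltSE _ bg).
  have [h [hT hU]] := IH b bg.1 a ab.
  rewrite (ultra_stageS bg).
  exists (fun x => diag (@U b) (h x)); split; first by right; exists h.
  move=> f [[ag' _]|[k /hU <- ->//]].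
  by rewrite ag' ltxx in ag.
- rewrite (ultra_stageL lim).
  eexists; split; first by right; exists ag.
  move=> f [[ag' _]|[al]]; first by have agg := ag; rewrite ag' ltxx in agg.
  by rewrite (bool_irrelevance al ag) => /same_map_eq.
Qed.

End UltrapowerHierarchy.

(* Main.v *)
(** The isomorphism at stage [g] is induced by a map [Phi] from the hereditary
functions of stage [g] to [ultrahier g], defined by structural recursion: an atom
goes to its image under the canonical map from stage 0, and a function [h] with
domain [I b] goes to the image, under the canonical map from stage [b + 1], of the
class of [j |-> Phi (h j)] modulo the ultrafilter on [I b]. The maps [Phi] commute
with the canonical maps of the ultrapower hierarchy; at a successor [g] of [b] this
gives that [Phi x] is the class of [j |-> Phi (theta g j x)], whatever the rank of
[x]. Induction on the stage then shows that [Phi] is onto, that [sim] is exactly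
its kernel, that it commutes with the function symbols, and that relations hold in
[ultrahier g] iff they hold for some [Phi]-preimages; the last point at successors
amounts to changing representatives on a set outside of the ultrafilter. *)

From mathcomp Require Import all_boot all_order.
From mathcomp Require Import boolp classical_sets filter.
Require Import Defs.

Set Implicit Arguments.
Unset Strict Implicit.
Unset Printing Implicit Defensive.

Import Order.TTheory.
Local Open Scope classical_set_scope.
Local Open Scope order_scope.

(** * Homomorphisms and quotients *)

(** Relations are preserved in one direction only; the converse direction is treated separately, in
    [ultrahier_bot] and [Phi_rel_lift]. *)
Definition homomorphism (s : signature) (M N : structure s) (h : M -> N) : Prop :=
  [/\ forall c, h (cstI M c) = cstI N c,
      forall f x, h (fctI M f x) = fctI N f (fun i => h (x i)) &
      forall r x, relI M r x -> relI N r (fun i => h (x i))].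

Lemma homomorphism_comp (s : signature) (M N P : structure s)
    (h : M -> N) (k : N -> P) :
  homomorphism h -> homomorphism k -> homomorphism (fun x => k (h x)).
Proof.
move=> [hc hf hr] [kc kf kr]; split=> [c|f x|r x Rx].
- by rewrite hc kc.
- by rewrite hf kf.
- exact: (kr r (fun i => h (x i)) (hr r x Rx)).
Qed.

Section Quotient.
Variables (T : Type) (R : T -> T -> Prop).
Hypothesis Rrefl : forall x, R x x.
Hypothesis Rsym : forall x y, R x y -> R y x.
Hypothesis Rtrans : forall x y z, R x y -> R y z -> R x z.

Lemma cls_eq x y : cls R x = cls R y <-> R x y.
Proof.
split=> [/(congr1 sval)/= E|xy].
  by have : [set z | R y z] y by []; rewrite -E.
apply/eq_exist/seteqP; split=> z /=; first exact/Rtrans/Rsym.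
exact: Rtrans.
Qed.

End Quotient.

(** * Ultrapowers by a proper filter *)

Section UltrapowerTheory.
Variables (s : signature) (J : Type) (D : set_system J) (M : structure s).
Hypothesis D_proper : ProperFilter D.

Local Notation ae := (@ae_eq s J D M).

Lemma ae_eq_cls (x y : J -> M) : cls ae x = cls ae y <-> ae x y.
Proof.
apply: cls_eq => [z|z t|z t u].
- by apply: filterE.
- by apply: filterS => j /esym.
- by apply: filterS2 => j /= -> ->.
Qed.

Lemma ae_eq_repr (x : J -> M) : ae x (repr (cls ae x)).
Proof. by apply/ae_eq_cls; rewrite reprK. Qed.

(** A filter is closed under finite intersections, so the chosen representatives of finitely many
    classes can be exchanged at once. This makes operations and relations of the ultrapower
    computable on arbitrary representatives. *)
Lemma ae_eq_repr_fin n (x : 'I_n -> J -> M) :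
  D [set j | (fun i => repr (cls ae (x i)) j) = (fun i => x i j)].
Proof.
suff : \forall j \near D, forall i, x i j = repr (cls ae (x i)) j.
  by apply: filterS => j xj /=; apply/funext => i.
by apply: filter_forall => i; exact: ae_eq_repr.
Qed.

Lemma ultrapower_fct (f : fsym s) (x : 'I_(far f) -> J -> M) :
  fctI (ultrapower D M) f (fun i => cls ae (x i)) =
  cls ae (fun j => fctI M f (fun i => x i j)).
Proof.
by apply/ae_eq_cls; apply: filterS (ae_eq_repr_fin x) => j /= ->.
Qed.

Lemma ultrapower_rel (r : rsym s) (x : 'I_(rar r) -> J -> M) :
  relI (ultrapower D M) r (fun i => cls ae (x i)) <->
  D [set j | relI M r (fun i => x i j)].
Proof.
split=> /= H; apply: filterS2 (ae_eq_repr_fin x) H => j /=.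
  by move=> ->.
by move=> ->.
Qed.

Lemma homomorphism_diag : homomorphism (@diag s J D M).
Proof.
split=> [//|f x|r x Rx]; first exact/esym/ultrapower_fct.
by apply/ultrapower_rel; apply: filterE.
Qed.

Lemma diag_inj : injective (@diag s J D M).
Proof. by move=> x y /ae_eq_cls/filter_ex[]. Qed.

End UltrapowerTheory.

(** * Direct limits of directed systems *)

Section DirectLimitTheory.
Variables (s : signature) (K : Type) (k0 : K) (M : K -> structure s).
Variable E : forall i j, (M i -> M j) -> Prop.
Hypothesis E_id : forall i, @E i i id.
Hypothesis E_comp : forall i j k (f : M i -> M j) (h : M j -> M k),
  E f -> E h -> E (fun x => h (f x)).
Hypothesis E_fun : forall i j (f h : M i -> M j), E f -> E h -> f = h.
Hypothesis E_dir : forall i j,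
  exists k (f : M i -> M k) (h : M j -> M k), E f /\ E h.
Hypothesis E_hom : forall i j (f : M i -> M j), E f -> homomorphism f.

Local Notation inc := (@dl_in s K M E _).

Lemma dl_in_eq i j (x : M i) (y : M j) : inc x = inc y <->
  exists k (f : M i -> M k) (h : M j -> M k), [/\ E f, E h & f x = h y].
Proof.
apply: (iff_trans (cls_eq _ _ _ _ _)) => //.
- by move=> [k z]; exists k, id, id.
- by move=> p q [k [f [h [Ef Eh fh]]]]; exists k, h, f.
- move=> [a x1] [b x2] [c x3] [k /= [f [h [/= Ef Eh fh]]]].
  move=> [k' /= [f' [h' [/= Ef' Eh' fh']]]].
  have [m [u [v [Eu Ev]]]] := E_dir k k'.
  exists m, (fun z => u (f z)), (fun z => v (h' z)).
  split=> /=; try exact: E_comp.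
  rewrite fh -fh'; have := E_fun (E_comp Eh Eu) (E_comp Ef' Ev).
  by move/(congr1 (fun F => F x2)).
Qed.

Lemma dl_in_trans i j (f : M i -> M j) (x : M i) : E f -> inc (f x) = inc x.
Proof. by move=> Ef; apply/dl_in_eq; exists j, id, f. Qed.

Lemma dl_in_surj (z : quot (dl_eq E)) : exists k (x : M k), z = inc x.
Proof. by rewrite -(reprK z); case: (repr z) => k x; exists k, x. Qed.

(** Directedness passes from two indices to finitely many by induction along the enumeration of
    ['I_n]; [k0] serves the empty list. *)
Lemma directed_fin n (P : 'I_n -> K -> Prop) :
  (forall i k k' (f : M k -> M k'), E f -> P i k -> P i k') ->
  (forall i, exists k, P i k) -> exists k, forall i, P i k.
Proof.
move=> mono exP.
suff [k Pk] : exists k, forall i, (i \in enum 'I_n) -> P i k.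
  by exists k => i; apply: Pk; rewrite mem_enum.
elim: (enum 'I_n) => [|i r [k IH]]; first by exists k0.
have [k' Pk'] := exP i; have [m [u [v [Eu Ev]]]] := E_dir k k'.
exists m => i'; rewrite inE => /predU1P[->|/IH]; first exact: mono Ev _.
exact: mono Eu.
Qed.

(** The value picked by [xget] comes from another representation [x'] of the tuple, at some [k'].
    Both representations agree at a common [m], and the transition maps commute with [f]. *)
Lemma dirlim_fct k (f : fsym s) (x : 'I_(far f) -> M k) :
  fctI (dirlim k0 E) f (fun i => inc (x i)) = inc (fctI (M k) f x).
Proof.
rewrite /=; case: xgetP => [z _ [k' [x' [xx' ->]]]|]; last first.
  by move=> /(_ (inc (fctI (M k) f x)))[]; exists k, x.
have [m /= Hm] : exists m, forall i, exists (u : M k -> M m) (v : M k' -> M m),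
    [/\ E u, E v & u (x i) = v (x' i)].
  apply: directed_fin => [i m m' w Ew [u [v [Eu Ev uv]]]|i].
    exists (fun z => w (u z)), (fun z => w (v z)).
    by split; [exact: E_comp|exact: E_comp|rewrite uv].
  exact/dl_in_eq/xx'.
(* The arity is positive, so the first argument supplies a pair of maps into [m]; by [E_fun] the
   pairs of the other arguments are the same. *)
have [u [v [Eu Ev _]]] := Hm (arg0 f).
rewrite -(dl_in_trans _ Eu) -(dl_in_trans _ Ev).
have [_ -> _] := E_hom Eu; have [_ -> _] := E_hom Ev.
congr (inc (fctI (M m) f _)); apply/funext => i.
have [u' [v' [Eu' Ev' uv']]] := Hm i.
by rewrite (E_fun Eu Eu') (E_fun Ev Ev') uv'.
Qed.

Lemma homomorphism_dl_map k : homomorphism (@dl_map s K k0 M E k).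
Proof.
split=> [c|f x|r x Rx].
- have [m [u [v [Eu Ev]]]] := E_dir k k0.
  rewrite /dl_map -(dl_in_trans _ Eu) /= -(dl_in_trans (cstI (M k0) c) Ev).
  by have [-> _ _] := E_hom Eu; have [-> _ _] := E_hom Ev.
- exact/esym/dirlim_fct.
- by exists k, x.
Qed.

Lemma dl_in_inj :
  (forall i j (f : M i -> M j), E f -> injective f) ->
  forall k, injective (fun x : M k => inc x).
Proof.
move=> Einj k x y /dl_in_eq[m [u [v [Eu Ev]]]].
by rewrite (E_fun Ev Eu); exact: Einj.
Qed.

End DirectLimitTheory.

(** * Successor and limit stages of the ultrapower hierarchy *)

Section UltrapowerHierarchyTheory.
Context {d : Order.disp_t} {O : bOrderType d}.
Hypothesis wfO : well_founded (fun x y : O => x < y).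
Variables (I : O -> Type) (U : forall b, set_system (I b)).
Hypothesis U_proper : forall b, ProperFilter (@U b).
Variables (s : signature) (A : structure s).

Local Notation Y := (ultrahier wfO U A).
Local Notation is_map a g := (@is_ultra_map d O wfO I U s A a g).

Lemma is_ultra_map_id g : is_map g g id.
Proof.
rewrite /is_ultra_map /ultrahier; case: (ord_caseP g) => [->|b bg|lim].
- by rewrite ultra_stage0; left.
- by rewrite (ultra_stageS _ _ _ bg); left.
- by rewrite (ultra_stageL _ _ _ lim); left.
Qed.

Lemma is_ultra_map_fun a g (f h : Y a -> Y g) :
  is_map a g f -> is_map a g h -> f = h.
Proof.
move=> Ef Eh; have [k [_ kP]] := ultra_map_unique wfO U A (ultra_trans_le Ef).
by rewrite -(kP _ Ef) -(kP _ Eh).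
Qed.

(** [ultrahierS] is an equality of structures, and transport along it would insert casts. The record
    instead describes stage [g] as an ultrapower of stage [b] through the class map [cl]. *)
Record succ_presentation b g (cl : (I b -> Y b) -> Y g) : Prop := SuccPresentation {
  succ_surj : forall y, exists x, y = cl x;
  succ_eq : forall x y, cl x = cl y <-> U [set j | x j = y j];
  succ_fct : forall f x,
    fctI (Y g) f (fun i => cl (x i)) = cl (fun j => fctI (Y b) f (fun i => x i j));
  succ_rel : forall r x,
    relI (Y g) r (fun i => cl (x i)) <-> U [set j | relI (Y b) r (fun i => x i j)];
  succ_hom : homomorphism (fun x : Y b => cl (fun _ => x));
  succ_map : forall a (h : Y a -> Y b), is_map a b h ->
    is_map a g (fun x => cl (fun _ => h x))
}.

Lemma ultrahier_succ b g : is_succ b g -> exists cl, @succ_presentation b g cl.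
Proof.
move=> bg.
(* Phrased with [ultra_stage], so that the recursion equation rewrites the structure and its
   incoming maps simultaneously. *)
suff H : exists cl : (I b -> Y b) -> str (ultra_stage wfO U A g),
  [/\ (forall y, exists x, y = cl x),
      (forall x y, cl x = cl y <-> U [set j | x j = y j]),
      (forall f x, fctI (str (ultra_stage wfO U A g)) f (fun i => cl (x i)) =
         cl (fun j => fctI (Y b) f (fun i => x i j))),
      (forall r x, relI (str (ultra_stage wfO U A g)) r (fun i => cl (x i)) <->
         U [set j | relI (Y b) r (fun i => x i j)]) &
      homomorphism (fun x : Y b => cl (fun _ => x)) /\
      forall a (h : Y a -> Y b), is_map a b h ->
        @trans _ _ _ (ultra_stage wfO U A g) a _ (fun x => cl (fun _ => h x))].
  by have [cl [? ? ? ? []]] := H; exists cl.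
rewrite (ultra_stageS _ _ _ bg); exists (cls (@ae_eq s (I b) (@U b) (Y b))).
split=> [y|x y|f x|r x|]; first by exists (repr y); rewrite reprK.
- exact: ae_eq_cls.
- exact: ultrapower_fct.
- exact: ultrapower_rel.
- split; first exact: homomorphism_diag.
  by move=> a h hM; right; exists h.
Qed.

(** Both clauses form one induction invariant: below a limit they turn the stages into a directed
    system to which the direct limit lemmas apply. *)
Definition good_maps_to g : Prop :=
  (forall a b (f : Y a -> Y b) (h : Y b -> Y g), is_map a b f -> is_map b g h ->
     is_map a g (fun x => h (f x))) /\
  (forall a (f : Y a -> Y g), is_map a g f -> homomorphism f /\ injective f).

(** The analogue at limits, where [inc] collects the canonical maps into the direct limit. *)
Record limit_presentation l (inc : forall a, a < l -> Y a -> Y l) : Prop :=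
    LimitPresentation {
  lim_map : forall a (al : a < l), is_map a l (inc a al);
  lim_comp : forall a b (al : a < l) (bl : b < l) (f : Y a -> Y b),
    is_map a b f -> forall x, inc b bl (f x) = inc a al x;
  lim_surj : forall y, exists a (al : a < l) x, y = inc a al x;
  lim_rel : forall r y, relI (Y l) r y ->
    exists a (al : a < l) x, (forall i, y i = inc a al (x i)) /\ relI (Y a) r x;
  lim_hom : forall a (al : a < l), homomorphism (inc a al);
  lim_inj : forall a (al : a < l), injective (inc a al)
}.

Lemma ultrahier_limit l : is_limit l -> (forall g, g < l -> good_maps_to g) ->
  exists inc, @limit_presentation l inc.
Proof.
move=> lim good.
suff H : exists inc : forall a, a < l -> Y a -> str (ultra_stage wfO U A l),
  [/\ (forall a (al : a < l),
         @trans _ _ _ (ultra_stage wfO U A l) a _ (inc a al)),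
      (forall a b (al : a < l) (bl : b < l) (f : Y a -> Y b),
         is_map a b f -> forall x, inc b bl (f x) = inc a al x),
      (forall y, exists a (al : a < l) x, y = inc a al x),
      (forall r y, relI (str (ultra_stage wfO U A l)) r y ->
         exists a (al : a < l) x,
           (forall i, y i = inc a al (x i)) /\ relI (Y a) r x) &
      forall a (al : a < l), homomorphism (inc a al) /\ injective (inc a al)].
  have [inc [? ? ? ? HI]] := H.
  by exists inc; split=> // a al; have [] := HI a al.
rewrite (ultra_stageL _ _ _ lim).
pose k0 : below l := exist _ \bot (limit_gt0 lim).
pose M (k : below l) := Y (sval k).
pose E (i j : below l) (f : M i -> M j) := is_map (sval i) (sval j) f.
have E_id i : @E i i id by exact: is_ultra_map_id.
have E_comp i j k (f : M i -> M j) (h : M j -> M k) :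
    E _ _ f -> E _ _ h -> E _ _ (fun x => h (f x)).
  by move=> Ef Eh; have [+ _] := good _ (svalP k); apply; [exact: Ef|exact: Eh].
have E_fun i j (f h : M i -> M j) : E _ _ f -> E _ _ h -> f = h.
  exact: is_ultra_map_fun.
have E_dir i j : exists k (f : M i -> M k) (h : M j -> M k), E _ _ f /\ E _ _ h.
  have [ij|/ltW ji] := leP (sval i) (sval j).
    by have [f [fM _]] := ultra_map_unique wfO U A ij; exists j, f, id.
  by have [f [fM _]] := ultra_map_unique wfO U A ji; exists i, id, f.
have E_good i j (f : M i -> M j) : E _ _ f -> homomorphism f /\ injective f.
  by move=> Ef; have [_] := good _ (svalP j); apply.
have E_hom i j (f : M i -> M j) : E _ _ f -> homomorphism f by move=> /E_good[].
have E_inj i j (f : M i -> M j) : E _ _ f -> injective f by move=> /E_good[].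
exists (fun a al => dl_map k0 E (k := exist _ a al)); split.
- by move=> a al; right; exists al.
- move=> a b al bl f fM x.
  exact: (@dl_in_trans s _ M E E_id E_comp E_fun E_dir
            (exist _ a al) (exist _ b bl)).
- by move=> y; have [[a al] [x ->]] := dl_in_surj y; exists a, al, x.
- by move=> r y [[a al] [x [yx Rx]]]; exists a, al, x.
- move=> a al; split; first exact: homomorphism_dl_map.
  exact: (dl_in_inj E_id E_comp E_fun E_dir E_inj (k := exist _ a al)).
Qed.

(** A canonical map into [g] is the identity, or a map into the predecessor followed by the
    diagonal, or an inclusion into the direct limit; each kind inherits both clauses from below. *)
Lemma ultra_maps_good g : good_maps_to g.
Proof.
elim/(well_founded_induction wfO): g => g IH.
have idE (h : Y g -> Y g) : is_map g g h -> h = id.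
  by move=> hM; apply: is_ultra_map_fun hM (is_ultra_map_id g).
have idG : homomorphism (@id (Y g)) /\ injective (@id (Y g)) by split.
case: (ord_caseP g) => [g0|b bg|lim].
- have le_bot c (h : Y c -> Y g) : is_map c g h -> c = g.
    by move=> /ultra_trans_le; rewrite g0 lex0 => /eqP.
  split=> [a c f h fM hM|a f fM].
    by have cg := le_bot _ _ hM; subst c; rewrite (idE h hM).
  by have ag := le_bot _ _ fM; subst a; rewrite (idE f fM).
- have [cl clP] := ultrahier_succ bg.
  (* The factorization comes from uniqueness: the canonical map into [b] followed by the diagonal is
     also canonical. *)
  have mapE a (f : Y a -> Y g) : a < g -> is_map a g f ->
      exists2 h : Y a -> Y b, is_map a b h & f = fun x => cl (fun _ => h x).
    rewrite (ltSE _ bg) => ab fM.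
    have [h [hM _]] := ultra_map_unique wfO U A ab; exists h => //.
    exact: is_ultra_map_fun fM (succ_map clP hM).
  split=> [a c f h fM hM|a f fM].
    have := ultra_trans_le hM; rewrite le_eqVlt => /predU1P[cg|cg].
      by subst c; rewrite (idE h hM).
    have [k kM ->] := mapE _ _ cg hM.
    by apply: (succ_map clP (h := fun x => k (f x))); exact: (IH b bg.1).1 fM kM.
  have := ultra_trans_le fM; rewrite le_eqVlt => /predU1P[ag|ag].
    by subst a; rewrite (idE f fM).
  have [k kM ->] := mapE _ _ ag fM; have [khom kinj] := (IH b bg.1).2 _ _ kM.
  split; first exact: homomorphism_comp khom (succ_hom clP).
  by move=> x y /(succ_eq clP)/filter_ex[_ /kinj].
- have [inc incP] := ultrahier_limit lim IH.
  split=> [a c f h fM hM|a f fM].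
    have := ultra_trans_le hM; rewrite le_eqVlt => /predU1P[cg|cg].
      by subst c; rewrite (idE h hM).
    have ag := le_lt_trans (ultra_trans_le fM) cg.
    rewrite (is_ultra_map_fun hM (lim_map incP cg)).
    have -> : (fun x => inc c cg (f x)) = inc a ag.
      by apply/funext => x; rewrite (lim_comp incP ag cg fM).
    exact: (lim_map incP).
  have := ultra_trans_le fM; rewrite le_eqVlt => /predU1P[ag|ag].
    by subst a; rewrite (idE f fM).
  rewrite (is_ultra_map_fun fM (lim_map incP ag)); split.
    exact: (lim_hom incP).
  exact: (lim_inj incP).
Qed.

(** * The chosen canonical maps and their functoriality *)

Definition emap a g (ag : a <= g) : Y a -> Y g :=
  projT1 (cid (ultra_map_unique wfO U A ag)).

Lemma emapP a g (ag : a <= g) : is_map a g (emap ag).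
Proof. by rewrite /emap; case: cid => f []. Qed.

Lemma emapE a g (ag : a <= g) f : is_map a g f -> emap ag = f.
Proof. exact/is_ultra_map_fun/emapP. Qed.

Lemma emap_id g (gg : g <= g) x : emap gg x = x.
Proof. by rewrite (emapE gg (is_ultra_map_id g)). Qed.

Lemma emap_comp a b g (ab : a <= b) (bg : b <= g) (ag : a <= g) x :
  emap bg (emap ab x) = emap ag x.
Proof.
have [+ _] := ultra_maps_good g => /(_ _ _ _ _ (emapP ab) (emapP bg)).
by move/(emapE ag) ->.
Qed.

Lemma emap_hom a g (ag : a <= g) : homomorphism (emap ag).
Proof. exact: ((ultra_maps_good g).2 _ _ (emapP ag)).1. Qed.

Lemma emap_inj a g (ag : a <= g) : injective (emap ag).
Proof. exact: ((ultra_maps_good g).2 _ _ (emapP ag)).2. Qed.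

Definition succ_cl b g (bg : is_succ b g) : (I b -> Y b) -> Y g :=
  projT1 (cid (ultrahier_succ bg)).

Lemma succ_clP b g (bg : is_succ b g) : succ_presentation (succ_cl bg).
Proof. by rewrite /succ_cl; case: cid. Qed.

Lemma emap_succ b g (bg : is_succ b g) (le_bg : b <= g) x :
  emap le_bg x = succ_cl bg (fun _ => x).
Proof. by rewrite (emapE _ (succ_map (succ_clP bg) (is_ultra_map_id b))). Qed.

Lemma ultrahier_lim_surj l (y : Y l) : is_limit l ->
  exists a (al : a < l) x, y = emap (ltW al) x.
Proof.
move=> lim; have [inc incP] := ultrahier_limit lim (fun g _ => ultra_maps_good g).
have [a [al [x ->]]] := lim_surj incP y; exists a, al, x.
by rewrite (emapE _ (lim_map incP al)).
Qed.

Lemma ultrahier_lim_rel l r (y : 'I_(rar r) -> Y l) : is_limit l ->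
  relI (Y l) r y ->
  exists a (al : a < l) x, (forall i, y i = emap (ltW al) (x i)) /\ relI (Y a) r x.
Proof.
move=> lim Ry.
have [inc incP] := ultrahier_limit lim (fun g _ => ultra_maps_good g).
have [a [al [x [yx Rx]]]] := lim_rel incP Ry; exists a, al, x; split=> // i.
by rewrite yx (emapE _ (lim_map incP al)).
Qed.

Lemma ultrahier_bot : exists h : A -> Y \bot,
  [/\ injective h, forall y, exists x, y = h x, homomorphism h &
      forall r x, relI (Y \bot) r (fun i => h (x i)) -> relI A r x].
Proof. by rewrite ultrahier0; exists id; split=> // y; exists y. Qed.

Definition bot_in : A -> Y \bot := projT1 (cid ultrahier_bot).

Lemma bot_inP :
  [/\ injective bot_in, forall y, exists x, y = bot_in x, homomorphism bot_in &
      forall r x, relI (Y \bot) r (fun i => bot_in (x i)) -> relI A r x].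
Proof. by rewrite /bot_in; case: cid. Qed.

(** * Ranks of functions in the cumulative hierarchy *)

Local Notation C := (@cph d O wfO I s A).
Local Notation rk := (@rho d O wfO I s A).
Local Notation th := (@theta d O wfO I s A).

Lemma succ_fun (b g g' : O) : is_succ b g -> is_succ b g' -> g = g'.
Proof.
move=> [bg gP] [bg' gP']; have [gg'|gg'|//] := ltgtP g g'.
  by have := gP' _ gg'; rewrite leNgt bg.
by have := gP _ gg'; rewrite leNgt bg'.
Qed.

Lemma rho_Fun g b (h : I b -> elt I A) : C g (Fun h) ->
  is_succ b (rk (Fun h)) /\ forall j, C b (h j).
Proof.
move=> gh; case: (ord_caseP (rk (Fun h))) => [r0|e er|lim].
- by have [] := rho0 gh r0.
- have [h' hC E] := rhoS gh er.
  have be : b = e.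
    by move/(congr1 (fun x => if x is Fun c _ then c else \bot)): E.
  subst e; split=> // j.
  (* [theta] at this rank returns [h j] on [Fun h], which avoids inverting the dependent equality
     [E]. *)
  have [rh _ _] := rhoP gh; have := theta_cph j er rh.
  by rewrite /theta lexx; case: eqP => // e; rewrite (Prop_irrelevance e erefl).
- by case: (rho_Nlimit gh).
Qed.

Lemma cph_Fun g b (h : I b -> elt I A) : C g (Fun h) ->
  exists c, [/\ is_succ b c, c <= g & forall j, C b (h j)].
Proof.
move=> gh; have [bc hC] := rho_Fun gh; exists (rk (Fun h)); split=> //.
by have [] := rhoP gh.
Qed.

Lemma cph_Fun_succ b g (h : I b -> elt I A) :
  is_succ b g -> (forall j, C b (h j)) -> C g (Fun h).
Proof. by move=> bg hC; rewrite (cphS _ _ _ bg); left; exists h. Qed.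

Lemma rho_Fun_succ b g (h : I b -> elt I A) :
  is_succ b g -> (forall j, C b (h j)) -> rk (Fun h) = g.
Proof.
by move=> bg /(cph_Fun_succ bg)/rho_Fun[bc _]; exact: succ_fun bc bg.
Qed.

Lemma theta_Fun b g (h : I b -> elt I A) (j : I b) : is_succ b g ->
  (forall j, C b (h j)) -> th g j (Fun h) = h j.
Proof.
move=> bg hC; rewrite /theta (rho_Fun_succ bg hC) lexx; case: eqP => // e.
by rewrite (Prop_irrelevance e erefl).
Qed.

Lemma theta_lt al b (j : I b) x : rk x < al -> th al j x = x.
Proof. by move=> xal; rewrite /theta leNgt xal. Qed.

(* Below rank [g] the domain of [x] is not [I b], so that [theta] is the
   identity. *)
Lemma theta_succ b g de (j : I b) x : is_succ b g -> C g x ->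
  rk x <= de -> de <= g -> th de j x = th g j x.
Proof.
move=> bg gx xd dg; have [_ _ xg] := rhoP gx.
have [rx|rx] := eqVneq (rk x) g.
  by suff -> : de = g by []; apply/eqP; rewrite eq_le dg -rx xd.
have xlt : rk x < g by rewrite lt_neqAle rx.
rewrite (theta_lt _ xlt) /theta; case: ifP => // _.
case: x gx xd xg rx xlt => // c h gh _ _ rx _; case: eqP => // bc; subst c.
by have [/succ_fun/(_ bg) rg _] := rho_Fun gh; rewrite rg eqxx in rx.
Qed.

(** * The map from hereditary functions to the ultrapower hierarchy *)

(** The stage stays universally quantified in the recursion, since the values of [h] are evaluated
    at stage [b] and not at [g]. *)
Fixpoint Phi (x : elt I A) : forall g, C g x -> Y g :=
  match x with
  | atom a => fun g _ => emap (le0x g) (bot_in a)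
  | Fun b h => fun g gh =>
    let: And3 bc cg hC := proj2_sig (cid (cph_Fun gh)) in
    emap cg (succ_cl bc (fun j => Phi (hC j)))
  end.

Lemma Phi_eq x y g (gx : C g x) (gy : C g y) : x = y -> Phi gx = Phi gy.
Proof. by move=> xy; subst y; rewrite (Prop_irrelevance gx gy). Qed.

(** The choice made by [cid] is immaterial: a successor is unique and the remaining data are
    proofs. *)
Lemma Phi_Fun b c g (h : I b -> elt I A) (gh : C g (Fun h))
    (bc : is_succ b c) (cg : c <= g) (hC : forall j, C b (h j)) :
  Phi gh = emap cg (succ_cl bc (fun j => Phi (hC j))).
Proof.
rewrite /=; case: cid => c' /= [bc' cg' hC'].
have E := succ_fun bc' bc; subst c'.
rewrite (Prop_irrelevance bc' bc) (bool_irrelevance cg' cg).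
by rewrite (Prop_irrelevance hC' hC).
Qed.

Lemma Phi_mono x a g (ax : C a x) (gx : C g x) (ag : a <= g) :
  Phi gx = emap ag (Phi ax).
Proof.
case: x ax gx => [y|b h] ax gx; first exact/esym/emap_comp.
have [c [bc ca hC]] := cph_Fun ax.
rewrite (Phi_Fun ax bc ca hC) (Phi_Fun gx bc (le_trans ca ag) hC).
exact/esym/emap_comp.
Qed.

(** If [x] has rank [g], [theta] reads off its components. If the rank is smaller, [theta] fixes
    [x], and the constant family is the diagonal, which is the canonical map from [b] to [g]. *)
Lemma Phi_succ b g x (bg : is_succ b g) (gx : C g x)
    (tx : forall j : I b, C b (th g j x)) :
  Phi gx = succ_cl bg (fun j => Phi (tx j)).
Proof.
have [_ _] := rhoP gx; rewrite le_eqVlt => /predU1P[rx|rx].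
  have er : is_succ b (rk x) by rewrite rx.
  have [h hC xh] := rhoS gx er; subst x.
  rewrite (Phi_Fun gx bg (lexx g) hC) emap_id; congr succ_cl.
  by apply/funext => j; apply: Phi_eq; rewrite theta_Fun.
have bx : C b x.
  have [+ _ _] := rhoP gx; apply: cph_mono; by rewrite -(ltSE _ bg).
rewrite (Phi_mono bx gx (ltW bg.1)) (emap_succ bg); congr succ_cl.
by apply/funext => j; apply: Phi_eq; rewrite theta_lt.
Qed.

Lemma Phi_surj g (y : Y g) : exists x (gx : C g x), Phi gx = y.
Proof.
elim/(well_founded_induction wfO): g y => g IH y.
case: (ord_caseP g) => [g0|b bg|lim].
- subst g; have [_ /(_ y)[x ->] _ _] := bot_inP.
  by exists (atom I x), (atom_cph wfO I x \bot); rewrite /= emap_id.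
- have [f ->] := succ_surj (succ_clP bg) y.
  have /choice[h hP] j : exists x, exists bx : C b x, Phi bx = f j.
    exact: IH bg.1 (f j).
  have hC j : C b (h j) by case: (hP j).
  exists (Fun h), (cph_Fun_succ bg hC).
  rewrite (Phi_Fun _ bg (lexx g) hC) emap_id; congr succ_cl.
  by apply/funext => j; have [? <-] := hP j; exact: Phi_eq.
- have [a [al [y' ->]]] := ultrahier_lim_surj y lim.
  have [x [ax <-]] := IH a al y'.
  have gx := cph_mono (ltW al) ax.
  by exists x, gx; exact: Phi_mono.
Qed.

(** * Similarity as the kernel of [Phi] *)

Section Similarity.
Variable V : forall b, set_system (I b).

Local Notation "x ~_ g y" := (sim wfO (A := A) V g x y)
  (at level 70, g at level 0, format "x  ~_ g  y").

Lemma sim0 x y : x ~_(\bot) y <-> C \bot x /\ x = y.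
Proof. by rewrite /sim ordrec0. Qed.

Lemma simS b g x y : is_succ b g -> x ~_g y <->
  [/\ C g x, C g y &
      V [set j : I b | th (Order.max (rk x) (rk y)) j x
                 ~_b th (Order.max (rk x) (rk y)) j y]].
Proof. by move=> bg; rewrite /sim (ordrecS _ _ _ _ bg). Qed.

Lemma simL l x y : is_limit l -> x ~_l y <-> exists2 a, a < l & x ~_a y.
Proof.
move=> lim; rewrite /sim (ordrecL _ _ _ _ lim).
by split=> -[a al] H; exists a => //; rewrite al in H *.
Qed.

Lemma sim_cph g x y : x ~_g y -> C g x /\ C g y.
Proof.
elim/(well_founded_induction wfO): g => g IH.
case: (ord_caseP g) => [->|b bg|lim].
- by move=> /sim0[gx <-].
- by move=> /(simS _ _ bg)[].
- move=> /(simL _ _ lim)[a al /(IH a al)[ax ay]].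
  by split; [exact: cph_mono (ltW al) _ ax|exact: cph_mono (ltW al) _ ay].
Qed.

Lemma simP g x y (gx : C g x) (gy : C g y) :
  (forall b, b < g -> @V b = @U b) -> x ~_g y <-> Phi gx = Phi gy.
Proof.
elim/(well_founded_induction wfO): g x y gx gy => g IH x y gx gy VU.
case: (ord_caseP g) => [g0|b bg|lim].
- subst g; rewrite sim0; split=> [[_ xy]|E]; first exact: Phi_eq.
  split=> //; move: (gx) (gy); rewrite cph0 => -[x' _ xE] [y' _ yE]; subst x y.
  have [inj0 _ _ _] := bot_inP.
  by move: E; rewrite /= => /emap_inj/inj0 ->.
- have dg : Order.max (rk x) (rk y) <= g.
    by rewrite ge_max; have [_ _ ->] := rhoP gx; have [_ _ ->] := rhoP gy.
  have tx (j : I b) := theta_cph j bg gx; have ty (j : I b) := theta_cph j bg gy.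
  rewrite (Phi_succ bg gx tx) (Phi_succ bg gy ty) (succ_eq (succ_clP bg)).
  rewrite (simS _ _ bg) (VU b bg.1).
  have -> : [set j : I b | th (Order.max (rk x) (rk y)) j x
                     ~_b th (Order.max (rk x) (rk y)) j y] =
            [set j | Phi (tx j) = Phi (ty j)].
    apply/seteqP.
    (* [sim] uses [theta] at the larger of the two ranks and [Phi_succ] uses it at [g]; [theta_succ]
       reconciles them. *)
    have E (j : I b) : th (Order.max (rk x) (rk y)) j x
        ~_b th (Order.max (rk x) (rk y)) j y <-> Phi (tx j) = Phi (ty j).
      rewrite (theta_succ j bg gx) // ?le_max ?lexx //.
      rewrite (theta_succ j bg gy) // ?le_max ?lexx ?orbT //.
      apply: IH bg.1 _ _ _ _ _ => c cb; apply: VU; exact: lt_trans cb bg.1.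
    by split=> j /E.
  by split=> [[]|].
- rewrite (simL _ _ lim); split.
    move=> [a al axy]; have [ax ay] := sim_cph axy.
    rewrite (Phi_mono ax gx (ltW al)) (Phi_mono ay gy (ltW al)); congr emap.
    apply/(IH a al _ _ ax ay) => // b ba; apply: VU; exact: lt_trans ba al.
  (* Both elements already lie in the larger [c] of their two earlier stages, and injectivity of the
     canonical map from [c] brings the equality down. *)
  move=> E; move: (gx) (gy); rewrite (cphL _ _ _ lim).
  move=> [a al ax] [b bl Cby]; pose c := Order.max a b.
  have cl : c < g by rewrite gt_max al.
  have cx : C c x by apply: cph_mono ax; rewrite le_max lexx.
  have cy : C c y by apply: cph_mono Cby; rewrite le_max lexx orbT.
  exists c => //; apply/(IH c cl _ _ cx cy).
    by move=> e ec; apply: VU; exact: lt_trans ec cl.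
  by move: E; rewrite (Phi_mono cx gx (ltW cl)) (Phi_mono cy gy (ltW cl)) => /emap_inj.
Qed.

End Similarity.

(** * Function and relation symbols under [Phi] *)

Local Notation fct := (@cph_fct d O wfO I s A).
Local Notation rel := (@cph_rel d O wfO I s A).
Local Notation mr := (@maxrho d O wfO I s A).

Variant maxrho_spec n (a : 'I_n -> elt I A) g : Prop :=
| MaxrhoBot x of mr a = \bot & a = (fun i => atom I (x i))
| MaxrhoSucc e of is_succ e (mr a) & mr a <= g & e < g &
    forall i, C (mr a) (a i).

(** The maximum of finitely many ranks is attained by one of the elements, hence is not a limit. *)
Lemma maxrhoP n (a : 'I_n -> elt I A) g : (0 < n)%N ->
  (forall i, C g (a i)) -> maxrho_spec a g.
Proof.
move=> n0 ga; have [i0 mE] := maxrho_ex wfO a n0.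
have mg : mr a <= g by rewrite mE; have [] := rhoP (ga i0).
case: (ord_caseP (mr a)) => [m0|e em|]; last by rewrite mE => /(rho_Nlimit (ga i0)).
- have /choice[x ax] i : exists x, a i = atom I x.
    apply: (rho0 (ga i)); apply/eqP; rewrite -lex0 -m0; exact: rho_le_max.
  by apply: (MaxrhoBot _ m0 (x := x)); apply/funext.
- apply: (MaxrhoSucc em mg) => [|i]; first exact: lt_le_trans em.1 mg.
  by have [ra _ _] := rhoP (ga i); exact: cph_mono (rho_le_max wfO a i) _ ra.
Qed.

Lemma maxrho_atom n (x : 'I_n -> A) : mr (fun i => atom I (x i)) = \bot.
Proof.
apply/eqP; rewrite -lex0; apply/bigmax_leP; split=> // i _.
by have [] := rhoP (atom_cph wfO I (x i) \bot).
Qed.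

Lemma cph_fct_atom f g (x : 'I_(far f) -> A) :
  fct g (fun i => atom I (x i)) = atom I (fctI A f x).
Proof.
rewrite /cph_fct wfrecE; case: ord_caseP => [_|e|[]].
- case: xgetP => [z _ [y [xy ->]]|]; last first.
    by move=> /(_ (atom I (fctI A f x)))[]; exists x.
  by congr (atom I (fctI A f _)); apply/funext => i; case: (xy i).
- by rewrite maxrho_atom => /succ_neq0.
- by rewrite maxrho_atom eqxx.
Qed.

Lemma cph_fct_succ f g e (a : 'I_(far f) -> elt I A) :
  is_succ e (mr a) -> e < g ->
  fct g a = Fun (fun j : I e => fct e (fun i => th (mr a) j (a i))).
Proof.
move=> em eg; rewrite /cph_fct wfrecE; case: ord_caseP => [m0|e' em'|[_ lim]].
- by case: (succ_neq0 em).
- by have E := succ_inj em' em; subst e'; rewrite eg.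
- by case: (lim e).
Qed.

Lemma cph_rel_atom r g (x : 'I_(rar r) -> A) :
  rel g (fun i => atom I (x i)) <-> relI A r x.
Proof.
rewrite /cph_rel wfrecE; case: ord_caseP => [_|e|[]].
- split=> [[y [xy]]|Rx]; last by exists x.
  by have -> : x = y by apply/funext => i; case: (xy i).
- by rewrite maxrho_atom => /succ_neq0.
- by rewrite maxrho_atom eqxx.
Qed.

Lemma cph_rel_succ r g e (a : 'I_(rar r) -> elt I A) :
  is_succ e (mr a) -> e < g ->
  rel g a <-> forall j : I e, rel e (fun i => th (mr a) j (a i)).
Proof.
move=> em eg; rewrite {1}/cph_rel wfrecE; case: ord_caseP => [m0|e' em'|[_ lim]].
- by case: (succ_neq0 em).
- by have E := succ_inj em' em; subst e'; rewrite eg.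
- by case: (lim e).
Qed.

(** At both stages the relation unfolds to the same condition, governed by the maximal rank
    alone. *)
Lemma cph_rel_mono r b g (a : 'I_(rar r) -> elt I A) : b <= g ->
  (forall i, C b (a i)) -> rel b a -> rel g a.
Proof.
move=> bg ba; case: (maxrhoP (rar_gt0 r) ba) => [x _ ->|e em _ eb _].
  by rewrite !cph_rel_atom.
by rewrite (cph_rel_succ em eb) (cph_rel_succ em (lt_le_trans eb bg)).
Qed.

(** The value is formed at the stage [mr a], where componentwise application becomes the ultrapower
    operation; the canonical map to [g] is a homomorphism and carries the result over. *)
Lemma Phi_fct f g (a : 'I_(far f) -> elt I A) (ga : forall i, C g (a i))
    (gF : C g (fct g a)) :
  Phi gF = fctI (Y g) f (fun i => Phi (ga i)).
Proof.
elim/(well_founded_induction wfO): g a ga gF => g IH a ga gF.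
case: (maxrhoP (far_gt0 f) ga) => [x _ ax|e em mg eg ma].
  subst a; rewrite (Phi_eq gF (atom_cph wfO I _ g) (cph_fct_atom g x)) /=.
  have [_ _ [_ -> _] _] := bot_inP; by have [_ -> _] := emap_hom (le0x g).
have ta (j : I e) i := theta_cph j em (ma i).
have tF j := cph_fct_closed (ta j).
have gF' := cph_mono mg (cph_Fun_succ em tF).
rewrite (Phi_eq gF gF' (cph_fct_succ em eg)) (Phi_Fun gF' em mg tF).
have -> : (fun j => Phi (tF j)) =
          (fun j => fctI (Y e) f (fun i => Phi (ta j i))).
  by apply/funext => j; exact: IH.
rewrite -(succ_fct (succ_clP em) (fun i j => Phi (ta j i))).
have [_ -> _] := emap_hom mg; congr (fctI (Y g) f); apply/funext => i.
by rewrite (Phi_mono (ma i) (ga i) mg) (Phi_succ em _ (fun j => ta j i)).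
Qed.

Lemma Phi_rel r g (a : 'I_(rar r) -> elt I A) (ga : forall i, C g (a i)) :
  rel g a -> relI (Y g) r (fun i => Phi (ga i)).
Proof.
elim/(well_founded_induction wfO): g a ga => g IH a ga.
case: (maxrhoP (rar_gt0 r) ga) => [x _ ax|e em mg eg ma].
  subst a => /cph_rel_atom Rx.
  have [_ _ [_ _ hom0] _] := bot_inP; have [_ _ homg] := emap_hom (le0x g).
  exact: homg _ _ (hom0 _ _ Rx).
move=> /(cph_rel_succ em eg) Ra.
have ta (j : I e) i := theta_cph j em (ma i).
have [_ _ homg] := emap_hom mg.
have -> : (fun i => Phi (ga i)) =
          (fun i => emap mg (succ_cl em (fun j => Phi (ta j i)))).
  apply/funext => i.
  by rewrite (Phi_mono (ma i) (ga i) mg) (Phi_succ em _ (fun j => ta j i)).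
apply: homg; apply/(succ_rel (succ_clP em)); apply: filterE => j /=.
exact: IH.
Qed.

(** [rel] asks for every index, the ultrapower only for almost every one, so given preimages may
    fail to be related. Suitable ones are therefore constructed. *)
Lemma Phi_rel_lift r g (y : 'I_(rar r) -> Y g) : relI (Y g) r y ->
  exists a (ga : forall i, C g (a i)), (forall i, Phi (ga i) = y i) /\ rel g a.
Proof.
elim/(well_founded_induction wfO): g y => g IH y.
case: (ord_caseP g) => [g0|b bg|lim].
- subst g; have [_ surj0 _ refl0] := bot_inP.
  have /choice[x xy] i := surj0 (y i).
  have -> : y = (fun i => bot_in (x i)) by apply/funext.
  move=> /refl0 Rx; exists (fun i => atom I (x i)).
  exists (fun i => atom_cph wfO I (x i) \bot); split; last exact/cph_rel_atom.
  by move=> i /=; rewrite emap_id.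
- have /choice[f fy] i := succ_surj (succ_clP bg) (y i).
  have -> : y = (fun i => succ_cl bg (f i)) by apply/funext.
  move=> /(succ_rel (succ_clP bg)) US; have [j0 /= Sj0] := filter_ex US.
  (* Off the set where the relation holds, the components are replaced by those
     at [j0]: [rel] requires the relation at every index. *)
  pose k j := if `[< relI (Y b) r (fun i => f i j) >] then j else j0.
  have Rk j : relI (Y b) r (fun i => f i (k j)).
    by rewrite /k; case: asboolP.
  have /choice[a aP] j := IH b bg.1 _ (Rk j).
  have aC j i : C b (a j i) by case: (aP j).
  pose h i := Fun (fun j => a j i).
  have hC i : C g (h i) by apply: (cph_Fun_succ bg) => j.
  have rh i : rk (h i) = g by apply: (rho_Fun_succ bg) => j.
  (* All components of the tuple are functions on [I b], hence of rank [g]; so [theta] at the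
     maximal rank returns exactly the tuples [a j]. *)
  have mh : mr h = g by have [i ->] := maxrho_ex wfO h (rar_gt0 r); exact: rh.
  exists h, hC; split=> [i|].
    rewrite (Phi_Fun _ bg (lexx g) (fun j => aC j i)) emap_id.
    apply/(succ_eq (succ_clP bg)); apply: filterS US => j /= Sj.
    have [ga [/(_ i) E _]] := aP j; rewrite (Phi_eq _ (ga i) erefl) E /k.
    by case: asboolP.
  apply/(@cph_rel_succ r g b h); [by rewrite mh|exact: bg.1|move=> j].
  have -> : (fun i => th (mr h) j (h i)) = a j.
    by apply/funext => i; rewrite mh theta_Fun.
  by have [ga []] := aP j.
- move=> /(ultrahier_lim_rel lim)[a [al [x [yx /(IH a al)[h [hC [hx Rh]]]]]]].
  exists h, (fun i => cph_mono (ltW al) (hC i)); split.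
    by move=> i; rewrite (Phi_mono (hC i) _ (ltW al)) hx yx.
  exact: cph_rel_mono (ltW al) hC Rh.
Qed.

(** * The induced isomorphism *)

(** By [simP] the relation [csim] is the kernel of [Phi], hence an equivalence, and [Phi] on
    representatives is injective on classes. The tuple from [Phi_rel_lift] is the witness required
    by relations of the quotient. *)
Lemma cumpower_isomorphic (V : forall b, set_system (I b)) g :
  (forall b, b < g -> @V b = @U b) -> isomorphic (cumpower wfO A V g) (Y g).
Proof.
move=> VU; pose sm := @csim d O wfO I s A V g.
have smP x y : sm x y <-> Phi (svalP x) = Phi (svalP y) by exact: simP.
have clsP x y : cls sm x = cls sm y <-> sm x y.
  apply: cls_eq => [t|t u|t u v]; rewrite !smP //.
  by move=> -> ->.
have reprP x : Phi (svalP (repr (cls sm x))) = Phi (svalP x).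
  by apply/smP/clsP; rewrite reprK.
exists (fun x : cumpower wfO A V g => Phi (svalP (repr x))); split.
- have /choice[inv invP] (y : Y g) : exists x : {x | C g x}, Phi (svalP x) = y.
    have [x [gx <-]] := Phi_surj y; exists (exist _ x gx); exact: Phi_eq.
  exists (fun y => cls sm (inv y)) => x.
    by rewrite -[RHS]reprK; apply/clsP/smP; rewrite invP.
  by rewrite reprP invP.
- move=> c; rewrite reprP (Phi_eq _ (atom_cph wfO I (cstI A c) g)) //=.
  by have [_ _ [-> _ _] _] := bot_inP; have [-> _ _] := emap_hom (le0x g).
- by move=> f x; rewrite reprP; exact: Phi_fct.
- move=> r x; split=> [[b [xb Rb]]|].
    have := Phi_rel (fun i => svalP (b i)) Rb; congr relI; apply/funext => i.
    exact/esym/smP/xb.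
  move=> /Phi_rel_lift[a [ga [aE Ra]]]; exists (fun i => exist _ (a i) (ga i)).
  split=> // i; apply/smP; rewrite -aE; exact: Phi_eq.
Qed.

End UltrapowerHierarchyTheory.

Theorem theorem4p25 (d : Order.disp_t) (O : bOrderType d)
    (wfO : well_founded (fun x y : O => (x < y)%O))
    (I : O -> Type) (I_gt1 : forall al, exists i j : I al, i <> j)
    (U : forall al, set_system (I al))
    (U_ultra : forall al, UltraFilter (U al))
    (s : signature) (A : structure s)
    (V : forall al, set_system (I al)) (g : O) :
  (forall be, (be < g)%O -> V be = U be) ->
  isomorphic (cumpower wfO A V g) (ultrahier wfO U A g).
Proof.
by apply: cumpower_isomorphic => b; exact: ultra_proper.
Qed.
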